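(* Let $m\geq n\geq 1$ be integers and let $X,Y\in M_{m\times n}(\mathbb{C})$ with $X\neq 0$. There is a complex symmetric $A\in M_{m}(\mathbb{C})$ such that $AX=Y$ if and only if $\operatorname{null} X\subseteq \operatorname{null} Y$ and $X^{\mathsf{T}}Y$ is complex symmetric.
   Context: $M_{m\times n}(\mathbb{C})$ is the set of complex $m\times n$ matrices and $M_m(\mathbb{C})=M_{m\times m}(\mathbb{C})$. $\operatorname{null} Z$ denotes the null space of $Z$, and $Z^{\mathsf{T}}$ its transpose (without conjugation). A square complex matrix $A$ is complex symmetric if $A=A^{\mathsf{T}}$. *)

(* Defs.v *)
From mathcomp Require Import all_boot all_order all_algebra.

Set Implicit Arguments.
Unset Strict Implicit.
Unset Printing Implicit Defensive.

Import GRing.Theory.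
Local Open Scope ring_scope.

(* The null space acts on column vectors, whereas kermx is the row kernel. *)
Definition null (K : fieldType) (m n : nat) (Z : 'M[K]_(m, n)) :
    {vspace 'cV[K]_n} :=
  lker (linfun (mulmx Z : 'cV[K]_n -> 'cV[K]_m)).

Lemma memv_null (K : fieldType) (m n : nat) (Z : 'M[K]_(m, n)) (v : 'cV[K]_n) :
  (v \in null Z) = (Z *m v == 0).
Proof. by rewrite memv_ker lfunE. Qed.

(* Main.v *)
Require Import Defs.
From mathcomp Require Import all_boot all_order all_algebra.
From mathcomp Require Import reals complex.

Set Implicit Arguments.
Unset Strict Implicit.
Unset Printing Implicit Defensive.

Import GRing.Theory.
Local Open Scope ring_scope.
Local Open Scope complex_scope.

(** Let G be a generalized inverse of X, so that X G X = X.  The inclusion of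
    null spaces gives Y G X = Y, so B = Y G solves B X = Y.  The matrix
    A = B + B^T - G^T (X^T Y) G is symmetric as soon as X^T Y is, and then
    B^T X = G^T Y^T X = G^T X^T Y = G^T (X^T Y) G X, whence A X = B X = Y. *)

(** Works column by column in [C]. The matrix form allows the inclusion to be applied to a whole
    square matrix at once. *)
Lemma null_subP (K : fieldType) (m1 m2 n : nat)
    (X : 'M[K]_(m1, n)) (Y : 'M[K]_(m2, n)) :
  reflect (forall p (C : 'M[K]_(n, p)), X *m C = 0 -> Y *m C = 0)
    (null X <= null Y)%VS.
Proof.
apply: (iffP subvP) => [sXY p C XC0 | sXY v].
  have YC0 j : Y *m col j C = 0.
    apply/eqP; rewrite -memv_null sXY // memv_null.
    by rewrite colE mulmxA XC0 mul0mx.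
  apply/matrixP=> i j; move/colP/(_ i): (YC0 j).
  by rewrite colE mulmxA -colE mxE => ->; rewrite !mxE.
by rewrite !memv_null => /eqP/sXY->.
Qed.

Lemma symmetric_solutionP (K : fieldType) (m n : nat) (X Y : 'M[K]_(m, n)) :
  (exists A : 'M[K]_m, A = A^T /\ A *m X = Y) <->
  ((null X <= null Y)%VS /\ X^T *m Y = (X^T *m Y)^T).
Proof.
split=> [[A [symA <-]] | [/null_subP sXY symXY]].
  split; first by apply/null_subP => p C XC0; rewrite -mulmxA XC0 mulmx0.
  by rewrite !trmx_mul trmxK -symA mulmxA.
have [G XGX] : exists G, X *m G *m X = X by exists (pinvmx X); exact: mulmxKpV.
have YGX : Y *m G *m X = Y.
  (* [Y - Y G X = Y (1 - G X)], and [X (1 - G X) = 0]. *)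
  apply/eqP; rewrite eq_sym -subr_eq0 -mulmxA -{1}[Y]mulmx1 -mulmxBr.
  by apply/eqP/sXY; rewrite mulmxBr mulmx1 mulmxA XGX subrr.
exists (Y *m G + (Y *m G)^T - G^T *m (X^T *m Y) *m G); split.
  rewrite linearB linearD /= trmxK [_^T + _]addrC; congr (_ - _).
  by rewrite (trmx_mul _ G) (trmx_mul G^T) trmxK -symXY !mulmxA.
rewrite mulmxBl mulmxDl YGX trmx_mul.
(* Reading [X] as [X^T^T] turns [Y^T *m X] into [(X^T *m Y)^T], where symmetry applies; the last two
   terms then cancel. *)
rewrite -[G^T *m Y^T *m X]mulmxA -{1}[X]trmxK -trmx_mul -symXY.
by rewrite -!mulmxA (mulmxA Y) YGX addrK.
Qed.

Theorem theorem9p1 (R : realType) (m n : nat) (hmn : (n <= m)%N)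
    (hn : (1 <= n)%N) (X Y : 'M[R[i]]_(m, n)) (hX : X != 0) :
  (exists A : 'M[R[i]]_m, A = A^T /\ A *m X = Y) <->
  ((null X <= null Y)%VS /\ X^T *m Y = (X^T *m Y)^T).
Proof. exact: symmetric_solutionP. Qed.
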